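(* Let $f:\mathbf{R}^N\to\mathbf{R}$ be partially separable of degree $\omega$ with block Lipschitz gradient with constants $L=(L_1,\dots,L_n)$. Let $\tau\in\{1,\dots,n\}$ and let $\hat S$ be the $\tau$-nice sampling. Then $$(f,\hat S)\sim ESO\left(1+\frac{(\omega-1)(\tau-1)}{\max(1,n-1)},\,L\right).$$
   Context: Blocks: $[n]=\{1,\dots,n\}$; $N=N_1+\dots+N_n$ with $N_i\ge1$; $U=[U_1,\dots,U_n]$ is a column permutation of the $N\times N$ identity matrix, with $U_i$ of size $N\times N_i$. For $x\in\mathbf{R}^N$, the $i$-th block is $x^{(i)}=U_i^Tx\in\mathbf{R}^{N_i}$, and for $S\subseteq[n]$, $x_{[S]}=\sum_{i\in S}U_ix^{(i)}$. $\langle\cdot,\cdot\rangle$ is the Euclidean inner product. For fixed symmetric positive definite matrices $B_i\in\mathbf{R}^{N_i\times N_i}$, $\|t\|_{(i)}=\langle B_it,t\rangle^{1/2}$ and $\|t\|_{(i)}^*=\langle B_i^{-1}t,t\rangle^{1/2}$. For $w\in\mathbf{R}^n_{++}$ (positive entries), $\|x\|_w=(\sum_{i=1}^nw_i\|x^{(i)}\|_{(i)}^2)^{1/2}$. Partially separable of degree $\omega$ ($\omega$ an integer, $1\le\omega\le n$): $f=\sum_{J\in\mathcal{J}}f_J$, where $\mathcal{J}$ is a finite collection, possibly with repetitions, of nonempty subsets of $[n]$ with $|J|\le\omega$ for all $J\in\mathcal{J}$, and each $f_J:\mathbf{R}^N\to\mathbf{R}$ is convex, differentiable and depends on the blocks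 $x^{(i)}$, $i\in J$, only. Block Lipschitz gradient with constants $L_1,\dots,L_n>0$: $\|U_i^T\nabla f(x+U_it)-U_i^T\nabla f(x)\|_{(i)}^*\le L_i\|t\|_{(i)}$ for all $x\in\mathbf{R}^N$, $i\in[n]$, $t\in\mathbf{R}^{N_i}$. The $\tau$-nice sampling is a random subset of $[n]$ uniformly distributed over all subsets of $[n]$ of cardinality $\tau$. ESO: for $\beta>0$, $w\in\mathbf{R}^n_{++}$ and a random subset $\hat S$ of $[n]$ such that $\mathbf{P}(i\in\hat S)$ is positive and independent of $i$, $(f,\hat S)\sim ESO(\beta,w)$ means that for all $x,h\in\mathbf{R}^N$, $$\mathbf{E}[f(x+h_{[\hat S]})]\le f(x)+\tfrac{\mathbf{E}[|\hat S|]}{n}\left(\langle\nabla f(x),h\rangle+\tfrac\beta2\|h\|_w^2\right).$$ *)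

(* Defs.v *)
From HB Require Import structures.
From mathcomp Require Import all_boot all_order all_algebra all_fingroup.
From mathcomp Require Import all_classical all_reals all_analysis.

Set Implicit Arguments.
Unset Strict Implicit.
Unset Printing Implicit Defensive.

Import Order.TTheory GRing.Theory Num.Theory.
Import numFieldNormedType.Exports.

Local Open Scope classical_set_scope.
Local Open Scope ring_scope.

(* R^N is 'cV[R]_(\sum_i Nb i), where Nb i is the dimension of the i-th block. *)

Definition inner (R : realType) (m : nat) (x y : 'cV[R]_m) : R :=
  \sum_j x j ord0 * y j ord0.

Definition sym_posdef (R : realType) (m : nat) (B : 'M[R]_m) : Prop :=
  B^T = B /\ forall t : 'cV[R]_m, t != 0 -> 0 < inner (B *m t) t.

Definition normB (R : realType) (m : nat) (B : 'M[R]_m) (t : 'cV[R]_m) : R :=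
  Num.sqrt (inner (B *m t) t).

Definition dual_normB (R : realType) (m : nat) (B : 'M[R]_m) (t : 'cV[R]_m) : R :=
  Num.sqrt (inner (invmx B *m t) t).

Definition grad (R : realType) (m : nat) (f : 'cV[R]_m -> R) (x : 'cV[R]_m) :
    'cV[R]_m :=
  \col_j 'D_(delta_mx j ord0) f x.

Definition is_column_perm_id (R : realType) (m : nat) (U : 'M[R]_m) : Prop :=
  exists s : 'S_m, U = col_perm s 1%:M.

(* U_i, the i-th group of columns in U = [U_1, ..., U_n] *)
Definition Ublock (R : realType) (n : nat) (Nb : 'I_n -> nat)
    (U : 'M[R]_(\sum_i Nb i)) (i : 'I_n) : 'M[R]_(\sum_i Nb i, Nb i) :=
  submxrow U i.

(* x^(i) *)
Definition block (R : realType) (n : nat) (Nb : 'I_n -> nat)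
    (U : 'M[R]_(\sum_i Nb i)) (x : 'cV[R]_(\sum_i Nb i)) (i : 'I_n) :
    'cV[R]_(Nb i) :=
  (Ublock U i)^T *m x.

(* x_[S] *)
Definition restrict_to (R : realType) (n : nat) (Nb : 'I_n -> nat)
    (U : 'M[R]_(\sum_i Nb i)) (x : 'cV[R]_(\sum_i Nb i)) (S : {set 'I_n}) :
    'cV[R]_(\sum_i Nb i) :=
  \sum_(i in S) Ublock U i *m block U x i.

(* ||x||_w *)
Definition normw (R : realType) (n : nat) (Nb : 'I_n -> nat)
    (U : 'M[R]_(\sum_i Nb i)) (B : forall i : 'I_n, 'M[R]_(Nb i))
    (w : 'I_n -> R) (x : 'cV[R]_(\sum_i Nb i)) : R :=
  Num.sqrt (\sum_i w i * normB (B i) (block U x i) ^+ 2).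

Definition depends_only_on (R : realType) (n : nat) (Nb : 'I_n -> nat)
    (U : 'M[R]_(\sum_i Nb i)) (J : {set 'I_n})
    (g : 'cV[R]_(\sum_i Nb i) -> R) : Prop :=
  forall x y : 'cV[R]_(\sum_i Nb i),
    (forall i, i \in J -> block U x i = block U y i) -> g x = g y.

(* The collection of sets J, with repetitions, is a family indexed by 'I_m. *)
Definition partially_separable (R : realType) (n : nat) (Nb : 'I_n -> nat)
    (U : 'M[R]_(\sum_i Nb i)) (omega : nat)
    (f : 'cV[R]_(\sum_i Nb i) -> R) : Prop :=
  exists (m : nat) (J : 'I_m -> {set 'I_n})
         (fJ : 'I_m -> 'cV[R]_(\sum_i Nb i) -> R),
    (forall x, f x = \sum_(k < m) fJ k x) /\
    (forall k, [/\ J k != finset.set0, (#|J k| <= omega)%N,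
       convex_function [set: 'cV[R]_(\sum_i Nb i)] (fJ k),
       forall x, differentiable (fJ k) x
       & depends_only_on U (J k) (fJ k)]).

Definition block_lipschitz_grad (R : realType) (n : nat) (Nb : 'I_n -> nat)
    (U : 'M[R]_(\sum_i Nb i)) (B : forall i : 'I_n, 'M[R]_(Nb i))
    (L : 'I_n -> R) (f : 'cV[R]_(\sum_i Nb i) -> R) : Prop :=
  forall (x : 'cV[R]_(\sum_i Nb i)) (i : 'I_n) (t : 'cV[R]_(Nb i)),
    dual_normB (B i) (block U (grad f (x + Ublock U i *m t)) i
                      - block U (grad f x) i)
      <= L i * normB (B i) t.

Definition random_subset (d : measure_display) (T : measurableType d) (n : nat)
    (S : T -> {set 'I_n}) : Prop :=
  forall A : {set 'I_n}, measurable (S @^-1` [set A]).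

Definition tau_nice (R : realType) (d : measure_display) (T : measurableType d)
    (P : probability T R) (n : nat) (tau : nat) (S : T -> {set 'I_n}) : Prop :=
  random_subset S /\
  forall A : {set 'I_n},
    P (S @^-1` [set A]) = (if #|A| == tau then ('C(n, tau)%:R)^-1 else 0)%:E.

(* The inclusion probabilities are positive and do not depend on the index. *)
Definition proper_uniform (R : realType) (d : measure_display)
    (T : measurableType d) (P : probability T R) (n : nat)
    (S : T -> {set 'I_n}) : Prop :=
  [/\ random_subset S,
      forall i : 'I_n, (0 < P [set t | i \in S t])%E
    & forall i j : 'I_n, P [set t | i \in S t] = P [set t | j \in S t]].

(* The first three conjuncts are the conditions on (beta, w, S) under which
   ESO(beta, w) is defined. *)
Definition ESO (R : realType) (d : measure_display) (T : measurableType d)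
    (P : probability T R) (n : nat) (Nb : 'I_n -> nat)
    (U : 'M[R]_(\sum_i Nb i)) (B : forall i : 'I_n, 'M[R]_(Nb i))
    (f : 'cV[R]_(\sum_i Nb i) -> R) (S : T -> {set 'I_n})
    (beta : R) (w : 'I_n -> R) : Prop :=
  [/\ 0 < beta,
      forall i, 0 < w i,
      proper_uniform P S
    & forall x h : 'cV[R]_(\sum_i Nb i),
      ('E_P[fun t => (f (x + restrict_to U h (S t)))%R]
        <= (f x)%:E
           + 'E_P[fun t => (#|S t|%:R)%R] * (n%:R^-1)%R%:E
             * (inner (grad f x) h + beta / 2 * normw U B w h ^+ 2)%R%:E)%E].

(* Main.v *)
(** Fix [x] and [h], write [h_i] for [U_i h^(i)], and enlarge each [J] so that
    [|J| = omega].  For [A] of size [tau] with [k = |J :&: A| > 0], convexity gives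
    [f_J (x + h_[A]) <= k^-1 * \sum_(i in J :&: A) f_J (x + k h_i)].  When this is
    summed over all [A], the term [f_J (x + k h_i)] with [i] in [J] occurs once
    for each [A] containing [i] with [|J :&: A| = k]; the number [c_k] of such [A]
    depends neither on [i] nor on [J], so the [f_J] recombine into
    [\sum_k c_k / k * \sum_i (f (x + k h_i) - f x)].  Each increment is at most
    [k <grad f x, h_i> + k^2 L_i / 2 * |h^(i)|^2] by the block Lipschitz
    condition, and double counting gives [\sum_k c_k = C(n-1, tau-1)] and
    [\sum_k k c_k = C(n-1, tau-1) + (omega-1) C(n-2, tau-2)]. *)
From mathcomp Require Import all_boot all_order all_algebra all_fingroup.
From mathcomp Require Import ring lra zify.

Set Implicit Arguments.
Unset Strict Implicit.
Unset Printing Implicit Defensive.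

Import Order.TTheory GRing.Theory Num.Theory.
Local Open Scope ring_scope.

(** * Counting subsets of fixed size by how they meet a given set *)

(** Such an [A] splits uniquely as [D], plus [k - #|D|] points of [J :\: D], plus [m - k] points
    outside [J]; [glue] is this bijection. The bounds on [k] make both truncated subtractions
    exact. *)
Lemma card_draws_meet (T : finType) (D J : {set T}) (k m : nat) :
  D \subset J -> (#|D| <= k <= m)%N ->
  #|[set A : {set T} | [&& D \subset A, #|A| == m & #|J :&: A| == k]]| =
    ('C(#|J| - #|D|, k - #|D|) * 'C(#|T| - #|J|, m - k))%N.
Proof.
move=> sDJ /andP[leDk lekm].
pose X := setX [set B : {set T} | B \subset J :\: D & #|B| == (k - #|D|)%N]
  [set C : {set T} | C \subset ~: J & #|C| == (m - k)%N].
pose glue (p : {set T} * {set T}) := D :|: p.1 :|: p.2.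
have inX p : (p \in X) =
    (p.1 \subset J :\: D) && (#|p.1| == (k - #|D|)%N) &&
    ((p.2 \subset ~: J) && (#|p.2| == (m - k)%N)).
  by case: p => b c; rewrite in_setX !inE.
have memX p : p \in X -> forall y,
    (y \in p.1 -> y \in J /\ y \notin D) /\ (y \in p.2 -> y \notin J).
  rewrite inX => /andP[/andP[/subsetP s1 _] /andP[/subsetP s2 _]] y.
  by split=> [/s1|/s2]; rewrite !inE // => /andP[].
have sDJ' y : y \in D -> y \in J by move/subsetP: sDJ => /(_ y).
(* Both components can be read off the union, whence the injectivity of [glue]. *)
have glue1 p : p \in X -> p.1 = glue p :&: (J :\: D).
  move=> /memX pX; apply/setP => y; rewrite !inE; have [p1 p2] := pX y.
  case: (boolP (y \in p.1)) => [/p1[-> ->]|_]; first by rewrite orbT.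
  case: (boolP (y \in p.2)) => [/p2/negbTE->|_]; first by rewrite !andbF.
  by case: (y \in D).
have glue2 p : p \in X -> p.2 = glue p :\: J.
  move=> /memX pX; apply/setP => y; rewrite !inE; have [p1 p2] := pX y.
  case: (boolP (y \in p.2)) => [/p2->|_]; first by rewrite orbT.
  case: (boolP (y \in p.1)) => [/p1[-> _]|_]; first by [].
  by case: (boolP (y \in D)) => [/sDJ'->|]; rewrite ?andbF.
have glue_inj : {in X &, injective glue}.
  move=> p q pX qX e; rewrite [p]surjective_pairing [q]surjective_pairing.
  by rewrite (glue1 _ pX) (glue2 _ pX) e -(glue1 _ qX) -(glue2 _ qX).
transitivity #|glue @: X|; last first.
  rewrite card_in_imset // cardsX !cards_draws cardsD (setIidPr sDJ).
  by rewrite -[#|~: J|](addKn #|J|) cardsC.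
congr #|pred_of_set _|; apply/setP => A; rewrite inE; apply/idP/imsetP.
  move=> /and3P[sDA /eqP cA /eqP cJA].
  exists (A :&: (J :\: D), A :\: J).
    rewrite inX /= subsetIr /= [A :\: J]setDE subsetIr /= -setDE.
    rewrite setIDA (setIC A) cardsD cJA (setIidPr _) ?subsetI ?sDJ //.
    by rewrite cardsD setIC cA cJA !eqxx.
  apply/setP => y; rewrite !inE /=; move/subsetP: sDA => /(_ y).
  by case: (y \in D); case: (y \in A); case: (y \in J) => //= /(_ isT).
move=> [p pX ->]; rewrite /glue.
have [d1 d2] : [disjoint D & p.1] /\ [disjoint D :|: p.1 & p.2].
  split; apply/pred0P => y /=; rewrite ?inE; have [p1 p2] := memX _ pX y.
    by apply/negP => /andP[yD /p1[_]]; rewrite yD.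
  apply/negP => /andP[yDp /p2 /negP]; apply.
  by case/orP: yDp => [/sDJ'|/p1[]].
have JI : J :&: (D :|: p.1 :|: p.2) = D :|: p.1.
  apply/setP => y; rewrite !inE; have [p1 p2] := memX _ pX y.
  case: (boolP (y \in p.2)) => [yp2|_]; last first.
    rewrite orbF; case: (boolP (y \in D)) => [/sDJ'->//|_].
    by case: (boolP (y \in p.1)) => [/p1[->]|]; rewrite ?andbF.
  rewrite (negbTE (p2 yp2)) /=; apply/esym/negbTE/negP.
  by case/orP => [/sDJ'|/p1[]] yJ; move: (p2 yp2); rewrite yJ.
rewrite JI -setUA subsetUl /= setUA.
move: pX; rewrite inX => /andP[/andP[_ /eqP c1] /andP[_ /eqP c2]].
rewrite !cardsU (disjoint_setI0 d1) (disjoint_setI0 d2) cards0 c1 c2 !subn0.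
by rewrite subnKC // subnKC // !eqxx.
Qed.

Lemma card_draws_superset (T : finType) (D : {set T}) (m : nat) :
  (#|D| <= m)%N ->
  #|[set A : {set T} | D \subset A & #|A| == m]| = 'C(#|T| - #|D|, m - #|D|).
Proof.
(* With [J] the whole type and [k = m], the meeting condition repeats the size condition and the
   second binomial is ['C(0, 0)]. *)
move=> leDm; have := @card_draws_meet T D setT m m (subsetT _).
rewrite leDm leqnn => /(_ isT); rewrite cardsT !subnn bin0 muln1 => <-.
by apply: eq_card => A; rewrite !inE setTI andbb.
Qed.

(** The number of such supersets is a positive binomial coefficient. This serves to enlarge each [J]
    to exactly [omega] elements. *)
Lemma exists_superset_card (T : finType) (D : {set T}) (m : nat) :
  (#|D| <= m <= #|T|)%N -> exists2 A : {set T}, D \subset A & #|A| = m.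
Proof.
move=> /andP[leDm lemT].
have : (0 < #|[set A : {set T} | D \subset A & #|A| == m]|)%N.
  by rewrite card_draws_superset // bin_gt0 leq_sub2r.
by rewrite card_gt0 => /set0Pn[A]; rewrite inE => /andP[sDA /eqP]; exists A.
Qed.

(** Group the [A] by [k = #|J :&: A|] and count each class with [D = [set i]]. The coefficients see
    [J] only through its size, and [i] not at all. The factor [0 < k] removes the class [k = 0],
    empty since [i] lies in [J :&: A], where [k.-1] would still be [0]. *)
Lemma sum_draws_meet (R : pzRingType) (T : finType) (J : {set T}) (i : T)
    (m : nat) (F : nat -> R) : i \in J ->
  \sum_(A : {set T} | (#|A| == m) && (i \in A)) F #|J :&: A| =
  \sum_(k < m.+1)
    ((0 < k)%N * 'C(#|J|.-1, k.-1) * 'C(#|T| - #|J|, m - k))%:R * F k.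
Proof.
move=> iJ.
have leJA (A : {set T}) : (#|A| == m) && (i \in A) -> (#|J :&: A| < m.+1)%N.
  by move=> /andP[/eqP <- _]; rewrite ltnS subset_leq_card // subsetIr.
rewrite (partition_big (fun A : {set T} => inord #|J :&: A| : 'I_m.+1)
  predT) //=.
apply: eq_bigr => k _.
rewrite (eq_bigl [in [set A : {set T} |
    [&& [set i] \subset A, #|A| == m & #|J :&: A| == k]]]); last first.
  move=> A; rewrite !inE sub1set andbA [(i \in A) && _]andbC.
  case: (boolP (_ && (i \in A))) => //= /leJA ltJA.
  by rewrite -val_eqE /= inordK.
rewrite (eq_bigr (fun=> F k)); last first.
  by move=> A; rewrite inE => /and3P[_ _ /eqP ->].
rewrite sumr_const -[LHS]mulr_natl; apply: (congr1 (fun c : nat => c%:R * F k)).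
case: (posnP k) => [k0|k_gt0].
  rewrite k0 !mul0n; apply/eqP; rewrite cards_eq0; apply/eqP/setP => A.
  rewrite !inE sub1set; apply/negP => /and3P[iA _].
  by rewrite cards_eq0 => /eqP/setP/(_ i); rewrite !inE iJ iA.
rewrite card_draws_meet ?sub1set // cards1 ?k_gt0 //; last exact: (ltn_ord k).
by rewrite !subn1 mul1n.
Qed.

(** Double counting of the pairs [(A, j)] with [j] in [J :&: A]: [j = i] gives the first term, each
    other [j] the same count of sets through two points. For [m = 1] that count is zero, but [m - 2]
    truncates to [0] and the binomial is [1]; hence the factor [1 < m]. *)
Lemma sum_draws_card_meet (T : finType) (J : {set T}) (i : T) (m : nat) :
  i \in J -> (0 < m)%N ->
  (\sum_(A : {set T} | (#|A| == m) && (i \in A)) #|J :&: A| =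
   'C(#|T|.-1, m.-1) +
   #|J|.-1 * ((1 < m) * 'C(#|T| - 2, m - 2)))%N.
Proof.
move=> iJ m_gt0.
under eq_bigr => A _ do rewrite -sum1_card big_mkcond /=.
rewrite exchange_big /= (bigID [in J]) /=
  [X in (_ + X)%N]big1 ?addn0; last first.
  by move=> j jJ; apply: big1 => A _; rewrite inE (negbTE jJ).
have count (j : T) : j \in J ->
    (\sum_(A : {set T} | (#|A| == m) && (i \in A))
       (if j \in J :&: A then 1 else 0) =
     #|[set A : {set T} | [set i; j] \subset A & #|A| == m]|)%N.
  move=> jJ; rewrite -big_mkcondr /= -sum1_card; apply: eq_bigl => A.
  rewrite !inE subUset !sub1set jJ /=.
  by case: (#|A| == m); case: (i \in A); case: (j \in A).
rewrite (bigD1 i) //= count // setUid.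
rewrite card_draws_superset ?cards1 // !subn1; congr (_ + _)%N.
rewrite (eq_bigr (fun=> (1 < m) * 'C(#|T| - 2, m - 2)))%N; last first.
  move=> j /andP[jJ ji]; rewrite count //.
  have cij : #|[set i; j]| = 2 by rewrite cards2 eq_sym ji.
  case: (ltnP 1 m) => [m1|m1].
    by rewrite card_draws_superset cij // mul1n.
  rewrite mul0n; apply/eqP; rewrite cards_eq0; apply/eqP/setP => A.
  rewrite !inE; apply/negP => /andP[/subset_leq_card].
  rewrite cij => le2 /eqP cA.
  by move: le2; rewrite cA leqNgt ltnS m1.
rewrite sum_nat_const; congr (_ * _)%N.
rewrite (cardD1 i J) iJ /=; apply: eq_card => j.
by rewrite !inE andbC.
Qed.

(** * The averaging inequality over all subsets of size [m] *)

(** The combinatorial core, isolated from blocks and derivatives: convexity enters only through the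
    Jensen hypothesis, smoothness only through the last one, where [a i] and [b i] are the linear
    and quadratic coefficients along [h i]. *)
Lemma sum_draws_convex_le (R : realFieldType) (V : lmodType R) (T : finType)
    (r m omega : nat) (J : 'I_r -> {set T}) (g : 'I_r -> V -> R)
    (x : V) (h : T -> V) (a b : T -> R) :
  (0 < omega <= #|T|)%N -> (0 < m)%N ->
  (forall s, #|J s| = omega) ->
  (forall s (A : {set T}), A != set0 ->
    g s (x + \sum_(i in A) h i) <=
      #|A|%:R^-1 * \sum_(i in A) g s (x + #|A|%:R *: h i)) ->
  (forall s (A : {set T}),
    g s (x + \sum_(i in A) h i) = g s (x + \sum_(i in J s :&: A) h i)) ->
  (forall s i (c : R), i \notin J s -> g s (x + c *: h i) = g s x) ->
  (forall i (c : R), 0 < c ->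
    \sum_s (g s (x + c *: h i) - g s x) <= c * a i + c ^+ 2 * b i) ->
  \sum_(A : {set T} | #|A| == m) \sum_s (g s (x + \sum_(i in A) h i) - g s x) <=
  \sum_i ('C(#|T|.-1, m.-1)%:R * a i +
    ('C(#|T|.-1, m.-1) +
     omega.-1 * ((1 < m) * 'C(#|T| - 2, m - 2)))%:R * b i).
Proof.
move=> /andP[omega_gt0 le_omega] m_gt0 cJ jensen dep indep descent.
(* [w 0 = 0], so the junk value [0^-1] below has weight zero. *)
pose w (k : nat) : nat :=
  ((0 < k) * 'C(omega.-1, k.-1) * 'C(#|T| - omega, m - k))%N.
have wE (D : {set T}) i (F : nat -> R) : #|D| = omega -> i \in D ->
    \sum_(A : {set T} | (#|A| == m) && (i \in A)) F #|D :&: A| =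
    \sum_(k < m.+1) (w k)%:R * F k.
  by move=> cD iD; rewrite sum_draws_meet // cD.
(* Jensen and regrouping come first; the smoothness bound is applied only once the [g s] have been
   summed over [s], since it concerns their sum. *)
apply: (@le_trans _ _ (\sum_(k < m.+1) (w k)%:R * (k%:R^-1 *
    \sum_i \sum_s (g s (x + k%:R *: h i) - g s x)))).
  rewrite exchange_big /=.
  under [leRHS]eq_bigr => k _.
    rewrite exchange_big /= !mulr_sumr.
    under eq_bigr => s _ do rewrite !mulr_sumr.
    over.
  rewrite [leRHS]exchange_big /=; apply: ler_sum => s _.
  rewrite [leRHS]exchange_big /= (bigID [in J s]) /=
    [X in _ <= _ + X]big1; last first.
    by move=> i iJ; apply: big1 => k _; rewrite indep // subrr !mulr0.
  rewrite addr0.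
  (* Reading [wE] backwards turns the weights into a sum over the [A] containing [i], so that the
     two sides can be compared for each [s] and [A] separately. *)
  under [leRHS]eq_bigr => i iJ do
    rewrite -(wE (J s) i
      (fun k => k%:R^-1 * (g s (x + k%:R *: h i) - g s x))) //.
  under [leRHS]eq_bigr => i iJ do rewrite big_mkcondr /=.
  rewrite exchange_big /=; apply: ler_sum => A _.
  rewrite -big_mkcondr /= [leRHS](eq_bigl [in J s :&: A]); last first.
    by move=> i; rewrite !inE.
  rewrite -mulr_sumr sumrB sumr_const dep.
  (* If [A] misses [J s], both sides are zero; otherwise Jensen applies to [J s :&: A]. *)
  have [->|JA] := eqVneq (J s :&: A) set0.
    by rewrite !big_set0 addr0 cards0 mulr0n subrr subr0 mulr0.
  rewrite mulrBr -(mulr_natl (g s x)) mulKf ?lerB ?jensen //.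
  by rewrite pnatr_eq0 cards_eq0.
apply: (@le_trans _ _ (\sum_(k < m.+1) (w k)%:R * (k%:R^-1 *
    \sum_i (k%:R * a i + k%:R ^+ 2 * b i)))).
  apply: ler_sum => k _; case: (posnP k) => [->|k_gt0].
    by rewrite /w !mul0n !mul0r.
  apply: ler_wpM2l => //; apply: ler_wpM2l; first by rewrite invr_ge0.
  by apply: ler_sum => i _; apply: descent; rewrite ltr0n.
under eq_bigr => k _ do rewrite !mulr_sumr.
rewrite exchange_big /= le_eqVlt; apply/predU1P; left.
apply: eq_bigr => i _.
(* The weights depend only on [omega], so any [D] of that size through [i] evaluates the sums of
   [w k] and of [w k * k]. *)
have [D siD cD] : exists2 D : {set T}, [set i] \subset D & #|D| = omega.
  by apply: exists_superset_card; rewrite cards1 omega_gt0.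
rewrite sub1set in siD.
have <- : \sum_(k < m.+1) (w k)%:R * 1%R = 'C(#|T|.-1, m.-1)%:R :> R.
  have := @card_draws_superset T [set i] m; rewrite cards1 !subn1 => <- //.
  rewrite -(wE D i (fun=> 1)) // sumr_const; congr (1 *+ _).
  by apply: eq_card => A; rewrite !inE sub1set andbC.
rewrite -cD -(sum_draws_card_meet siD) // natr_sum (wE D i (fun k => k%:R)) //.
rewrite !mulr_suml -big_split /=; apply: eq_bigr => k _.
case: (posnP k) => [->|k_gt0]; first by rewrite /w !mul0n !mul0r addr0.
have k_neq0 : k%:R != 0 :> R by rewrite pnatr_eq0 -lt0n.
by field.
Qed.

Require Import Defs.
From mathcomp Require Import all_classical all_reals all_analysis.
Import numFieldNormedType.Exports.
Local Open Scope classical_set_scope.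
Local Open Scope ring_scope.

(** * Jensen's inequality for arithmetic means *)

(** Induction on [#|A|]: the mean over [A] is the combination of [y i], with weight [c = #|A|^-1],
    and of the mean over [A :\ i], with weight [1 - c = c * #|A :\ i|]. *)
Lemma convex_function_mean (R : realType) (V : lmodType R) (T : finType)
    (g : V -> R) (A : {set T}) (y : T -> V) :
  convex_function [set: convex_lmodType V] g -> A != finset.set0 ->
  g (#|A|%:R^-1 *: \sum_(i in A) y i) <= #|A|%:R^-1 * \sum_(i in A) g (y i).
Proof.
move=> cvx; have [k] := ubnP #|A|; elim: k => // k IH in A *.
rewrite ltnS => leAk /finset.set0Pn[i iA].
have cA : #|A| = #|A :\ i|.+1 by rewrite (cardsD1 i) iA.
rewrite !(big_setD1 i iA) /=.
have [A0|A0] := eqVneq (A :\ i) finset.set0.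
  by rewrite cA A0 cards0 !big_set0 invr1 scale1r mul1r !addr0.
have := IH (A :\ i); rewrite -cA leAk A0 => /(_ isT isT) IHA.
set c := #|A|%:R^-1 : R.
have c_ge0 : 0 <= c by rewrite invr_ge0.
have c_le1 : c <= 1 by rewrite invf_le1 ?ler1n ?ltr0n cA.
have m_neq0 : #|A :\ i|%:R != 0 :> R by rewrite pnatr_eq0 cards_eq0.
have cE : 1 - c = c * #|A :\ i|%:R.
  by rewrite /c cA -natr1; field; rewrite natr1 pnatr_eq0.
have cvx2 (u v : V) : g (c *: u + (1 - c) *: v) <= c * g u + (1 - c) * g v.
  by have := @cvx (Itv01 c_ge0 c_le1) u v; rewrite !inE => /(_ I I).
have := cvx2 (y i) (#|A :\ i|%:R^-1 *: \sum_(j in A :\ i) y j).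
rewrite scalerA cE mulfK // -scalerDr => /le_trans; apply.
rewrite mulrDr lerD2l -mulrA ler_wpM2l // -ler_pdivlMl //.
by rewrite ltr0n card_gt0.
Qed.

(** * Inner products, dual norms and directional derivatives *)

Lemma innerE (R : realType) (m : nat) (x y : 'cV[R]_m) :
  inner x y = (x^T *m y) ord0 ord0.
Proof. by rewrite mxE; apply: eq_bigr => j _; rewrite mxE. Qed.

Section Inner.
Variables (R : realType) (m : nat).
Implicit Types (x y z : 'cV[R]_m) (c : R) (B : 'M[R]_m).

Lemma innerC x y : inner x y = inner y x.
Proof. by apply: eq_bigr => j _; rewrite mulrC. Qed.

Lemma innerDl x y z : inner (x + y) z = inner x z + inner y z.
Proof. by rewrite !innerE linearD /= mulmxDl mxE. Qed.

Lemma innerZl c x y : inner (c *: x) y = c * inner x y.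
Proof. by rewrite !innerE linearZ /= -scalemxAl mxE. Qed.

Lemma innerDr x y z : inner x (y + z) = inner x y + inner x z.
Proof. by rewrite innerC innerDl !(innerC x). Qed.

Lemma innerZr c x y : inner x (c *: y) = c * inner x y.
Proof. by rewrite innerC innerZl innerC. Qed.

Lemma inner_sumr (I : finType) (F : I -> 'cV[R]_m) x :
  inner x (\sum_i F i) = \sum_i inner x (F i).
Proof.
by rewrite innerE mulmx_sumr summxE; apply: eq_bigr => i _; rewrite innerE.
Qed.

Lemma inner_mulmxr p (M : 'M[R]_(m, p)) x (t : 'cV[R]_p) :
  inner x (M *m t) = inner (M^T *m x) t.
Proof. by rewrite !innerE trmx_mul trmxK mulmxA. Qed.

Lemma posdef_inner_ge0 B x : sym_posdef B -> 0 <= inner (B *m x) x.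
Proof.
move=> [_ posB]; have [->|/posB/ltW//] := eqVneq x 0.
by rewrite innerE mulmx0 mxE.
Qed.

(** A row [v] in the kernel of [B] makes the form vanish at [v^T], so [v = 0]. *)
Lemma posdef_unitmx B : sym_posdef B -> B \in unitmx.
Proof.
move=> [symB posB]; rewrite -row_free_unit -kermx_eq0.
apply/rowV0P => v /sub_kermxP vB; apply/eqP; apply: contraT => v0.
have /posB : v^T != 0 by rewrite -(trmx0 _ _ _) (inj_eq trmx_inj).
by rewrite innerE trmx_mul symB trmxK vB mul0mx mxE ltxx.
Qed.

Lemma posdef_cauchy_schwarz B x y : sym_posdef B ->
  inner (B *m x) y ^+ 2 <= inner (B *m x) x * inner (B *m y) y.
Proof.
move=> posB; have [->|y0] := eqVneq y 0.
  by rewrite !innerE !(mulmx0, trmx0, mul0mx) mxE expr0n mulr0.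
have pos_yy := proj2 posB _ y0.
have sym : inner (B *m y) x = inner (B *m x) y.
  by rewrite innerC inner_mulmxr (proj1 posB).
(* The form at its minimizer on the line x + R y, with denominators cleared. *)
have := posdef_inner_ge0
  (inner (B *m y) y *: x + (- inner (B *m x) y) *: y) posB.
rewrite mulmxDr -!scalemxAr !(innerDl, innerDr, innerZl, innerZr) sym => ge0.
rewrite -subr_ge0 -(pmulr_rge0 _ pos_yy).
by apply: le_trans ge0 _; rewrite le_eqVlt; apply/predU1P; left; ring.
Qed.

(** With [z = invmx B *m x], so that [x = B *m z], the dual norm of [x] is the [B]-norm of [z], and
    this is Cauchy-Schwarz for [z] and [y]. *)
Lemma inner_le_dual_norm B x y : sym_posdef B ->
  inner x y <= dual_normB B x * normB B y.
Proof.
move=> posB; have uB := posdef_unitmx posB.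
have xE : x = B *m (invmx B *m x) by rewrite mulmxA mulmxV // mul1mx.
have invE : inner (invmx B *m x) x = inner (B *m (invmx B *m x)) (invmx B *m x).
  by rewrite -xE innerC.
rewrite /dual_normB /normB -sqrtrM ?invE ?posdef_inner_ge0 //.
rewrite (le_trans (ler_norm _)) // -sqrtr_sqr ler_wsqrtr //.
by rewrite {1}xE posdef_cauchy_schwarz.
Qed.

Lemma normBZ B c x : 0 <= c -> normB B (c *: x) = c * normB B x.
Proof.
move=> c_ge0.
rewrite /normB -scalemxAr innerZl innerZr mulrA -expr2 sqrtrM ?sqr_ge0 //.
by rewrite sqrtr_sqr ger0_norm.
Qed.

(** [grad] is built from partial derivatives; linearity of the differential extends them to every
    direction. *)
Lemma derive_inner_grad (f : 'cV[R]_m -> R) x v :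
  differentiable f x -> 'D_v f x = inner (grad f x) v.
Proof.
move=> df; rewrite deriveE //.
have -> : v = \sum_j v j ord0 *: delta_mx j ord0.
  by rewrite {1}[v]matrix_sum_delta; apply: eq_bigr => j _; rewrite big_ord1.
rewrite linear_sum inner_sumr; apply: eq_bigr => j _.
rewrite linearZ innerZr -deriveE //; congr (_ * _).
rewrite /inner (bigD1 j) //= big1 ?addr0 => [|k kj]; rewrite !mxE ?eqxx ?mulr1 //.
by rewrite (negbTE kj) mulr0.
Qed.

End Inner.

(** The difference quotient of the restriction to the line is that of [f] in the direction [v]. *)
Lemma is_derive_line (R : realType) (V : normedModType R) (f : V -> R)
    (x v : V) (s : R) :
  differentiable f (x + s *: v) ->
  is_derive s 1 (fun s : R => f (x + s *: v)) ('D_v f (x + s *: v)).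
Proof.
move=> df.
have quotE : (fun h : R => h^-1 *: (((fun s : R => f (x + s *: v)) \o shift s)
      (h *: 1) - f (x + s *: v))) =
    (fun h : R => h^-1 *: ((f \o shift (x + s *: v)) (h *: v) - f (x + s *: v))).
  apply/funext => h /=.
  by rewrite (_ : h *: 1 = h) ?scalerDl 1?addrCA //; exact: mulr1.
split; first by rewrite /derivable quotE; exact: diff_derivable.
by rewrite /derive quotE.
Qed.

(** * Block decomposition and the descent inequality along one block *)

Section Blocks.
Variables (R : realType) (n : nat) (Nb : 'I_n -> nat).
Variable U : 'M[R]_(\sum_i Nb i).
Hypothesis U_perm : is_column_perm_id U.

(** The first identity makes the blocks orthonormal, the second makes them span the whole space. *)
Lemma perm_id_orthogonal : U^T *m U = 1%:M /\ U *m U^T = 1%:M.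
Proof.
have [s ->] := U_perm.
have -> : col_perm s 1%:M = perm_mx s^-1 :> 'M[R]_(\sum_i Nb i).
  by rewrite col_permE mul1mx.
by rewrite tr_perm_mx invgK -!perm_mxM mulgV mulVg perm_mx1.
Qed.

(** The value is kept as a block of the identity because [Nb i] and [Nb j] may differ; it is the
    identity for [i = j] and zero otherwise. *)
Lemma Ublock_ortho i j :
  (Ublock U i)^T *m Ublock U j = submxblock (1%:M : 'M[R]_(\sum_i Nb i)) i j.
Proof.
have [<- _] := perm_id_orthogonal.
rewrite /Ublock tr_submxrow submxcol_mul mul_submxrow.
by apply/matrixP => a b; rewrite !mxE.
Qed.

Lemma block_Ublock i
    (t : 'cV[R]_(Nb i)) : block U (Ublock U i *m t) i = t.
Proof.
by rewrite /block mulmxA Ublock_ortho -mxdiagZ submxblock_diag mul1mx.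
Qed.

Lemma block_Ublock_neq i j (t : 'cV[R]_(Nb j)) :
  i != j -> block U (Ublock U j *m t) i = 0.
Proof.
move=> ij; rewrite /block mulmxA Ublock_ortho -mxdiagZ mxblockK.
by rewrite (negbTE ij) mul0mx.
Qed.

Lemma sum_UblockK : \sum_i Ublock U i *m (Ublock U i)^T = 1%:M.
Proof.
have [_ <-] := perm_id_orthogonal.
by rewrite -[in RHS](submxrowK U) tr_mxrow mul_mxrow_mxcol.
Qed.

Lemma inner_block x y :
  inner x y = \sum_i inner (block U x i) (block U y i).
Proof.
rewrite -[in LHS](mul1mx y) -sum_UblockK mulmx_suml inner_sumr.
by apply: eq_bigr => i _; rewrite -mulmxA inner_mulmxr.
Qed.

Lemma blockD x y i : block U (x + y) i = block U x i + block U y i.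
Proof. exact: mulmxDr. Qed.

Lemma block_sum_Ublock (t : forall i, 'cV[R]_(Nb i)) (A : {set 'I_n}) i :
  block U (\sum_(j in A) Ublock U j *m t j) i = if i \in A then t i else 0.
Proof.
rewrite [LHS]mulmx_sumr; case: ifPn => iA.
  rewrite (bigD1 i) //= -/(block _ _ _) block_Ublock big1 ?addr0 //.
  move=> j /andP[_ ji].
  by rewrite -/(block _ _ _) block_Ublock_neq // eq_sym.
apply: big1 => j jA; rewrite -/(block _ _ _) block_Ublock_neq //.
by apply: contraNneq iA => ->.
Qed.

(** Let [F s] be [f] along the segment minus its quadratic model. The claim is [F 1 <= F 0], which
    the mean value theorem reduces to [dF r <= 0] at one interior point [r]. *)
Lemma block_descent (B : forall i, 'M[R]_(Nb i)) (L : 'I_n -> R)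
    (f : 'cV[R]_(\sum_i Nb i) -> R) (x : 'cV[R]_(\sum_i Nb i)) i
    (t : 'cV[R]_(Nb i)) :
  sym_posdef (B i) -> (forall y, differentiable f y) ->
  block_lipschitz_grad U B L f ->
  f (x + Ublock U i *m t) <=
    f x + inner (block U (grad f x) i) t + L i / 2 * normB (B i) t ^+ 2.
Proof.
move=> posB df lip; set v := Ublock U i *m t.
pose K := L i * normB (B i) t ^+ 2; pose c := inner (block U (grad f x) i) t.
pose F (s : R) : R := f (x + s *: v) - (s * c + s ^+ 2 * (K / 2)).
pose dF (s : R) := inner (grad f (x + s *: v)) v - (c + s * K).
have derF (s : R) : is_derive s 1 F (dF s).
  rewrite /dF -derive_inner_grad //.
  apply: is_deriveB; first exact: is_derive_line.
  apply: is_derive_eq; rewrite /GRing.scale /=; lra.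
have [r] : exists2 r, r \in `]0, 1[%R & F 1 - F 0 = dF r * (1 - 0).
  apply: (MVT ltr01 (fun s _ => derF s)).
  by apply: derivable_within_continuous => s _; have [] := derF s.
rewrite in_itv /= => /andP[r_gt0 _] FE.
suff dF_le0 : dF r <= 0.
  have : F 1 - F 0 <= 0 by rewrite FE subr0 mulr1.
  rewrite /F scale1r scale0r addr0 /K -/c; lra.
(* The gradient increment is paired with [t] through the dual norm, and the Lipschitz condition is
   used for the displacement [r *: t]. *)
have : inner (block U (grad f (x + r *: v)) i - block U (grad f x) i) t <= r * K.
  apply: le_trans (inner_le_dual_norm _ _ posB) _.
  have := lip x i (r *: t); rewrite -scalemxAr -/v => lip_r.
  rewrite (normBZ _ _ (ltW r_gt0)) in lip_r.
  have := ler_wpM2r (sqrtr_ge0 _ : 0 <= normB (B i) t) lip_r.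
  by move/le_trans; apply; rewrite /K le_eqVlt; apply/predU1P; left; ring.
rewrite /dF {2}/v inner_mulmxr -/(block _ _ _) innerDl -scaleN1r innerZl -/c.
lra.
Qed.

End Blocks.

(** * Expectations over random subsets *)

Section RandomSubset.
Variables (R : realType) (d : measure_display) (T : measurableType d).
Variables (P : probability T R) (n : nat) (S : T -> {set 'I_n}).

(** [F (S t)] is a finite combination of indicators of the fibres of [S], measurable by
    [random_subset], and is integrated term by term. *)
Lemma expectation_random_subset (F : {set 'I_n} -> R) : random_subset S ->
  ('E_P[fun t => F (S t)] = \sum_A (F A)%:E * P (S @^-1` [set A]))%E.
Proof.
move=> mS; rewrite unlock.
transitivity
    (\int[P]_t \sum_A ((F A)%:E * (\1_(S @^-1` [set A]) t)%:E))%E.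
  apply: eq_integral => t _; rewrite (bigD1 (S t)) //= big1 ?adde0.
    by rewrite indicE mem_set // mule1.
  move=> A AS; rewrite indicE memNset ?mule0 // => e.
  by move: AS; rewrite -e eqxx.
rewrite integral_sum //.
  apply: eq_bigr => A _; rewrite integralZl //; last exact: integrable_indic.
  by rewrite integral_indic // setIT.
by move=> A; apply: integrableZl => //; exact: integrable_indic.
Qed.

Lemma expectation_tau_nice (tau : nat) (F : {set 'I_n} -> R) :
  tau_nice P tau S ->
  'E_P[fun t => F (S t)]%E =
    ('C(n, tau)%:R^-1 * \sum_(A : {set 'I_n} | #|A| == tau) F A)%:E.
Proof.
move=> [mS PS]; rewrite expectation_random_subset //.
rewrite mulr_sumr [in RHS]big_mkcond /= -sumEFin; apply: eq_bigr => A _.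
by rewrite PS -EFinM; case: ifP; rewrite ?mulr0 1?mulrC.
Qed.

(** The event is a finite union of fibres, and its probability is the expectation of its indicator,
    which counts the sets of size [tau] through [i]. *)
Lemma tau_nice_inclusion (tau : nat) (i : 'I_n) : (0 < tau)%N ->
  tau_nice P tau S ->
  P [set t | i \in S t] = ('C(n, tau)%:R^-1 * 'C(n.-1, tau.-1)%:R)%:E.
Proof.
move=> tau_gt0 nice; have [mS _] := nice.
have mi : measurable [set t | i \in S t].
  rewrite (_ : [set t | _] =
      \big[setU/set0]_(A : {set 'I_n} | i \in A) (S @^-1` [set A])).
    by apply: bigsetU_measurable => A _; exact: mS.
  apply/seteqP; split=> [t /= iS|t].
    by rewrite -bigcup_seq_cond; exists (S t) => //=; rewrite mem_index_enum.
  by rewrite -bigcup_seq_cond => -[A /= /andP[_ iA] ->].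
rewrite -expectation_indic //.
rewrite (_ : \1_ _ = (fun t => (i \in S t)%:R : R)); last first.
  by apply/funext => t; rewrite indicE; congr (_%:R); rewrite mem_setE.
rewrite (expectation_tau_nice (fun A => (i \in A)%:R) nice).
rewrite -natr_sum; congr (_ * _%:R)%:E.
have := @card_draws_superset _ [set i]%SET tau.
rewrite cards1 card_ord !subn1 => <- //.
rewrite -sum1_card big_mkcond [RHS]big_mkcond; apply: eq_bigr => A _.
by rewrite !inE finset.sub1set; case: (i \in A); case: (#|A| == tau).
Qed.

End RandomSubset.

(** * Binomial ratios for the nice sampling *)

Lemma bin_pred_div (R : realType) (n m : nat) : (0 < m <= n)%N ->
  'C(n, m)%:R^-1 * 'C(n.-1, m.-1)%:R = m%:R / n%:R :> R.
Proof.
move=> /andP[m_gt0 lemn]; have n_gt0 := leq_trans m_gt0 lemn.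
have := mul_bin_diag n m.-1; rewrite prednK // => /(congr1 (fun k => k%:R : R)).
rewrite !natrM => E.
have C0 : 'C(n, m)%:R != 0 :> R by rewrite pnatr_eq0 -lt0n bin_gt0.
have n0 : n%:R != 0 :> R by rewrite pnatr_eq0 -lt0n.
apply: (mulfI C0); rewrite mulVKf //; apply: (mulfI n0); rewrite E.
by field.
Qed.

(** This is where [beta] arises: [bin_pred_div] is used for [(n, m)] and again for
    [(n.-1, m.-1)]. *)
Lemma nice_sampling_factor (R : realType) (n omega m : nat) :
  (0 < omega <= n)%N -> (0 < m <= n)%N ->
  'C(n, m)%:R^-1 * ('C(n.-1, m.-1) +
     omega.-1 * ((1 < m) * 'C(n - 2, m - 2)))%:R =
  m%:R / n%:R *
    (1 + (omega%:R - 1) * (m%:R - 1) / Num.max 1 (n%:R - 1)) :> R.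
Proof.
move=> /andP[omega_gt0 le_omega] mn; have /andP[m_gt0 lemn] := mn.
rewrite natrD mulrDr bin_pred_div // mulrDr mulr1; congr (_ + _).
have -> : omega%:R - 1 = omega.-1%:R :> R.
  by rewrite -[in LHS](prednK omega_gt0) -natr1 addrK.
(* For [m = 1] both correction terms vanish, which covers [n = 1]. Otherwise [n > 1] and the maximum
   is [n - 1]. *)
case: (ltnP 1 m) => [m_gt1|m_le1]; last first.
  have -> : m = 1%N by apply/eqP; rewrite eqn_leq m_le1.
  by rewrite mul0n muln0 subrr !(mulr0, mul0r).
have n_gt1 : (1 < n)%N by exact: leq_trans lemn.
have nE : n%:R - 1 = n.-1%:R :> R.
  by rewrite -[in LHS](ltn_predK n_gt1) -natr1 addrK.
have mE : m%:R - 1 = m.-1%:R :> R.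
  by rewrite -[in LHS](ltn_predK m_gt1) -natr1 addrK.
rewrite max_r; last by rewrite nE ler1n -ltnS (ltn_predK n_gt1).
rewrite mul1n natrM nE mE.
have p1 : (0 < m.-1 <= n.-1)%N by lia.
have := bin_pred_div R p1; rewrite -!subn2 => E1.
have := bin_pred_div R mn => E2.
have C1 : 'C(n.-1, m.-1)%:R != 0 :> R.
  by rewrite pnatr_eq0 -lt0n bin_gt0; case/andP: p1.
have -> : 'C(n - 2, m - 2)%:R = 'C(n.-1, m.-1)%:R * (m.-1%:R / n.-1%:R) :> R.
  by rewrite -E1 mulVKf.
by rewrite -E2; ring.
Qed.

Theorem theorem14 (R : realType) (n : nat) (Nb : 'I_n -> nat)
    (Nb_gt0 : forall i, (0 < Nb i)%N)
    (U : 'M[R]_(\sum_i Nb i)) (U_perm : is_column_perm_id U)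
    (B : forall i : 'I_n, 'M[R]_(Nb i)) (B_spd : forall i, sym_posdef (B i))
    (omega : nat) (omega_bounds : (1 <= omega <= n)%N)
    (f : 'cV[R]_(\sum_i Nb i) -> R) (f_sep : partially_separable U omega f)
    (L : 'I_n -> R) (L_gt0 : forall i, 0 < L i)
    (f_lip : block_lipschitz_grad U B L f)
    (tau : nat) (tau_bounds : (1 <= tau <= n)%N)
    (d : measure_display) (T : measurableType d) (P : probability T R)
    (S : T -> {set 'I_n}) (S_nice : tau_nice P tau S) :
  ESO P U B f S
    (1 + (omega%:R - 1) * (tau%:R - 1) / Num.max 1 (n%:R - 1)) L.
Proof.
have nice := S_nice; have [mS PS] := nice.
have /andP[tau_gt0 le_tau] := tau_bounds.
have /andP[omega_gt0 le_omega] := omega_bounds.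
have n_gt0 := leq_trans tau_gt0 le_tau.
set beta := 1 + _.
have C_gt0 : (0 < 'C(n, tau)%:R :> R) by rewrite ltr0n bin_gt0.
split=> //.
- apply: ltr_pwDl => //; apply: mulr_ge0.
    by rewrite mulr_ge0 // subr_ge0 ler1n.
  by rewrite invr_ge0 le_max ler01.
- split=> // [i|i j]; rewrite !(tau_nice_inclusion _ _ nice) //.
  rewrite lte_fin mulr_gt0 ?invr_gt0 // ltr0n bin_gt0.
  by rewrite -ltnS !prednK.
move=> x h.
rewrite (expectation_tau_nice (fun A => f (x + restrict_to U h A)) nice).
rewrite (expectation_tau_nice (fun A => #|A|%:R) nice).
rewrite -!EFinM -EFinD lee_fin.
have card_draws_tau : \sum_(A : {set 'I_n} | #|A| == tau) 1%R = 'C(n, tau)%:R :> R.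
  rewrite sumr_const; congr (1 *+ _); rewrite -[in RHS](card_ord n) -card_draws.
  by apply: eq_card => A; rewrite !inE.
(* The expected size is thus [tau], and the factor in the ESO becomes [tau / n]. *)
have -> : \sum_(A : {set 'I_n} | #|A| == tau) #|A|%:R = 'C(n, tau)%:R * tau%:R :> R.
  rewrite -card_draws_tau mulr_suml; apply: eq_bigr => A /eqP ->.
  by rewrite mul1r.
rewrite mulKf ?gt_eqF //.
have [r [J [fJ [fE fJP]]]] := f_sep.
have df y : differentiable f y.
  have -> : f = \sum_(k < r) fJ k.
    by apply/funext => z; rewrite fE fct_sumE.
  by apply: differentiable_sum => k; have [_ _ _ dfJ _] := fJP k; exact: dfJ.
(* A common size [omega] gives all summands the same weights; depending only on the blocks in [J k]
   implies depending only on those in the larger [J' k]. *)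
have /choice[J' J'P] k : exists D : {set 'I_n}, J k \subset D /\ #|D| = omega.
  have [_ cJ _ _ _] := fJP k.
  have [|D sD cD] := @exists_superset_card _ (J k) omega; last by exists D.
  by rewrite cJ card_ord.
have dep k y z : (forall i, i \in J' k -> block U y i = block U z i) ->
    fJ k y = fJ k z.
  move=> yz; have [_ _ _ _ +] := fJP k; apply => i iJ; apply: yz.
  by have [/fintype.subsetP sJ _] := J'P k; apply: sJ.
pose hb i := Ublock U i *m block U h i.
pose a i := inner (block U (grad f x) i) (block U h i).
pose b i := L i / 2 * normB (B i) (block U h i) ^+ 2.
have -> : normw U B L h ^+ 2 = 2 * \sum_i b i.
  rewrite /normw sqr_sqrtr; last first.
    by apply: sumr_ge0 => i _; rewrite mulr_ge0 ?sqr_ge0 // ltW.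
  by rewrite mulr_sumr; apply: eq_bigr => i _; rewrite /b; field.
have := @sum_draws_convex_le R _ _ r tau omega J' fJ x hb a b.
rewrite card_ord => /(_ omega_bounds tau_gt0) main.
have {}main := main (fun k => proj2 (J'P k)).
have {}main : \sum_(A : {set 'I_n} | #|A| == tau)
      \sum_s (fJ s (x + \sum_(i in A) hb i) - fJ s x) <=
    \sum_i ('C(n.-1, tau.-1)%:R * a i +
      ('C(n.-1, tau.-1) +
       omega.-1 * ((1 < tau) * 'C(n - 2, tau - 2)))%:R * b i).
  apply: main => [k A A0|k A|k i c iJ|i c c_gt0].
  (* The points [x + #|A| *: hb i], for [i] in [A], have mean [x + \sum_(i in A) hb i]. *)
  - have [_ _ cvx _ _] := fJP k.
    have := convex_function_mean (fun i => x + #|A|%:R *: hb i) cvx A0.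
    congr (fJ k _ <= _).
    rewrite big_split /= sumr_const scalerDr -[x *+ _]scaler_nat scalerA
      mulVf; last first.
      by rewrite pnatr_eq0 cards_eq0.
    rewrite scale1r -scaler_sumr scalerA mulVf ?scale1r //.
    by rewrite pnatr_eq0 cards_eq0.
  - apply: dep => i iJ; rewrite !blockD; congr (_ + _).
    by rewrite !block_sum_Ublock // inE iJ.
  - apply: dep => j jJ; rewrite blockD scalemxAr block_Ublock_neq ?addr0 //.
    by apply: contraNneq iJ => <-.
  - rewrite sumrB -!fE lerBlDl.
    have := block_descent x (c *: block U h i) (B_spd i) df f_lip.
    rewrite -scalemxAr -/(hb i) => /le_trans; apply.
    rewrite innerZr -addrA lerD2l lerD2l.
    rewrite (normBZ _ _ (ltW c_gt0)) exprMn /b.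
    by rewrite le_eqVlt; apply/predU1P; left; ring.
(* [main] bounds increments, so one copy of [f x] is split off for each [A]. *)
have sumE : \sum_(A : {set 'I_n} | #|A| == tau) f (x + restrict_to U h A) =
    'C(n, tau)%:R * f x + \sum_(A : {set 'I_n} | #|A| == tau)
      \sum_s (fJ s (x + \sum_(i in A) hb i) - fJ s x).
  rewrite -card_draws_tau mulr_suml -big_split; apply: eq_bigr => A _ /=.
  by rewrite sumrB -!fE mul1r subrKC.
rewrite sumE mulrDr mulKf ?gt_eqF // lerD2l.
apply: le_trans (ler_wpM2l _ main) _; first by rewrite invr_ge0 ltW.
(* Division by ['C(n, tau)] turns the linear coefficient into [tau / n] and the quadratic one into
   [tau / n * beta]; the [a i] add up to the full inner product. *)
rewrite big_split -!mulr_sumr /= mulrDr !mulrA bin_pred_div //.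
rewrite nice_sampling_factor // -/beta -(inner_block U_perm).
by rewrite le_eqVlt; apply/predU1P; left; field; rewrite pnatr_eq0 -lt0n.
Qed.
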